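(* Let $u,v\in\mathfrak S_n$. A flag positroid pipe dream $\mathrm{FPP}(u,v)$ (of $u$ with exit permutation $v$) exists if and only if $u\le v$ in Bruhat order. Moreover, the length $\ell(v)-\ell(u)$ of the interval $[u,v]$ equals the number of elbow tiles (not counting pivot elbows) in $\mathrm{FPP}(u,v)$.
   Context: Permutations $u=u_1\cdots u_n\in\mathfrak S_n$ are in one-line notation; $\ell$ is Coxeter length and $\le$ is Bruhat order. Use an $n\times n$ array, box $(i,j)$ in row $i$ from the top, column $j$ from the left. Tiles: empty; horizontal pipe (joins midpoints of left and right edges); vertical pipe (joins midpoints of top and bottom edges); pivot elbow (one arc joining top-edge midpoint to right-edge midpoint); cross (a horizontal and a vertical pipe); elbow (two arcs: top-edge midpoint to right-edge midpoint, and left-edge midpoint to bottom-edge midpoint). A Rothe pipe dream of $u$ is a tiling with: (i) $n$ pipes, each starting at the top edge and ending at the right edge; (ii) $(i,u_i)$ is a pivot elbow for each $i$; (iii) boxes $(i,j)$ with $u^{-1}(j)<i$, $j<u_i$ are empty; (iv) boxes $(i,j)$ with $u^{-1}(j)<i$, $j>u_i$ are horizontal pipes; (v) boxes $(i,j)$ with $u^{-1}(j)>i$, $j<u_i$ are vertical pipes (so boxes with $u^{-1}(j)>i$, $j>u_i$ are crosses or elbows). It is reduced if no two pipes cross (share a cross tile) more than once. The pipe starting at the top of column $j$ is labelled $j$; the exit permutation $v$ of a reduced Rothe pipe dream has $v_i$ = label of the pipe leaving the right edge in row $i$. Two pipes touch if they pass through a common elbow tile. A flag positroid pipe dream $\mathrm{FPP}(u,v)$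 is a reduced Rothe pipe dream of $u$ with exit permutation $v$ such that whenever two pipes cross, they do not touch in any box southeast of their crossing. *)

(* Defs.v *)
From HB Require Import structures.
From mathcomp Require Import all_boot all_order all_algebra all_fingroup.

Set Implicit Arguments.
Unset Strict Implicit.
Unset Printing Implicit Defensive.

(* A word [u] = u_1 ... u_n in one-line notation is [u : 'S_n] with u_i = u i,
   rows, columns and values being indexed from 0. *)

Section CoxeterLength.

Local Open Scope group_scope.

Definition simple_transpositions (n : nat) : {set 'S_n} :=
  [set tperm p.1 p.2 | p : 'I_n * 'I_n & p.2 == p.1.+1 :> nat].

Lemma tperm_in_gen_simple (n : nat) (i j : 'I_n) :
  tperm i j \in <<simple_transpositions n>>.
Proof.
wlog lt_ij : i j / i < j.
  move=> IH; case: (ltngtP i j) => [|lt_ji|/val_inj ->]; first exact: IH.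
    by rewrite tpermC IH.
  by rewrite tperm1 group1.
have [m] := ubnP (j - i); elim: m => // m IHm in i j lt_ij *.
move=> /ltnSE le_m.
have lt_i1n : i.+1 < n by apply: leq_ltn_trans (ltn_ord j).
pose k := Ordinal lt_i1n.
have ik_gen : tperm i k \in <<simple_transpositions n>>.
  by apply/mem_gen/imsetP; exists (i, k); rewrite ?inE /=.
have [eq_kj|neq_kj] := eqVneq k j; first by rewrite -eq_kj.
have lt_kj : k < j by rewrite ltn_neqAle lt_ij andbT.
have neq_ij : i != j by rewrite -val_eqE /= ltn_eqF.
rewrite -(tpermJ_tperm neq_kj neq_ij) groupJ ?[tperm k i]tpermC //.
rewrite IHm //.
by apply: leq_trans le_m; rewrite subnS prednK // subn_gt0.
Qed.

Lemma has_simple_word (n : nat) (u : 'S_n) :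
  exists k, u \in simple_transpositions n ^+ k.
Proof.
have /gen_prodgP[k [c Sc ->]] : u \in <<simple_transpositions n>>.
  have [ts -> _] := prod_tpermP u.
  by rewrite group_prod // => -[i j] _; apply: tperm_in_gen_simple.
exists k; rewrite -[k in _ ^+ k]card_ord -prodg_const.
by apply/prodsgP; exists c.
Qed.

(* The set power [simple_transpositions n ^+ k] consists of the products of
   words of length k in the simple transpositions. *)
Definition coxeter_length (n : nat) (u : 'S_n) : nat :=
  ex_minn (has_simple_word u).

(* [tperm a b * u] is u with its entries in positions a and b exchanged. *)
Definition bruhat_step (n : nat) : rel 'S_n :=
  [rel u w : 'S_n |
    [exists a : 'I_n, exists b : 'I_n, w == tperm a b * u]
    && (coxeter_length u < coxeter_length w)].

Definition bruhat_le (n : nat) : rel 'S_n := connect (@bruhat_step n).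

End CoxeterLength.

Inductive tile : Type :=
  Empty | Horizontal | Vertical | PivotElbow | Cross | Elbow.

Definition tile_eq_dec (s t : tile) : {s = t} + {s <> t}.
Proof. by decide equality. Defined.

HB.instance Definition _ := hasDecEq.Build tile (compareP tile_eq_dec).

(* Midpoints of the edges of the boxes: [inl (i, j)] lies on the top edge of
   box (i, j) (on the bottom boundary of the array if i = n), and [inr (i, j)]
   on the left edge of box (i, j) (on the right boundary if j = n). *)
Definition midpoint (n : nat) : Type := ('I_n.+1 * 'I_n + 'I_n * 'I_n.+1)%type.

Section Midpoints.

Variables (n : nat) (i j : 'I_n).

Definition top_mid : midpoint n := inl (widen_ord (leqnSn n) i, j).
Definition bottom_mid : midpoint n := inl (lift ord0 i, j).
Definition left_mid : midpoint n := inr (i, widen_ord (leqnSn n) j).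
Definition right_mid : midpoint n := inr (i, lift ord0 j).

(* Arcs are directed down or to the right, the direction in which a pipe is
   traversed from the top edge of the array. *)
Definition tile_arcs (t : tile) : seq (midpoint n * midpoint n) :=
  match t with
  | Empty => [::]
  | Horizontal => [:: (left_mid, right_mid)]
  | Vertical => [:: (top_mid, bottom_mid)]
  | PivotElbow => [:: (top_mid, right_mid)]
  | Cross => [:: (left_mid, right_mid); (top_mid, bottom_mid)]
  | Elbow => [:: (top_mid, right_mid); (left_mid, bottom_mid)]
  end.

End Midpoints.

Section Pipes.

Variables (n : nat) (T : 'M[tile]_n).

Definition arc : rel (midpoint n) :=
  [rel p q : midpoint n |
    [exists i : 'I_n, exists j : 'I_n, (p, q) \in tile_arcs i j (T i j)]].

Definition pipe_start (k : 'I_n) : midpoint n := inl (ord0, k).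
Definition row_exit (i : 'I_n) : midpoint n := inr (i, ord_max).

(* Midpoint p lies on the pipe labelled k. *)
Definition on_pipe (k : 'I_n) (p : midpoint n) : bool :=
  connect arc (pipe_start k) p.

Definition passes_through (k i j : 'I_n) : bool :=
  has (fun a => on_pipe k a.1) (tile_arcs i j (T i j)).

Definition cross_at (k l i j : 'I_n) : bool :=
  [&& T i j == Cross, passes_through k i j & passes_through l i j].

Definition touch_at (k l i j : 'I_n) : bool :=
  [&& T i j == Elbow, passes_through k i j & passes_through l i j].

(* The tiling consists of n pipes, one from the top of each column, each
   reaching the right boundary: no drawn arc is outside these pipes. *)
Definition n_pipes_top_to_right : Prop :=
  (forall k : 'I_n, exists i : 'I_n, on_pipe k (row_exit i)) /\
  (forall p q : midpoint n, arc p q -> exists k : 'I_n, on_pipe k p).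

Definition is_rothe_pipe_dream (u : 'S_n) : Prop :=
  [/\ n_pipes_top_to_right,
      forall i : 'I_n, T i (u i) = PivotElbow,
      forall i j : 'I_n, (u^-1)%g j < i -> j < u i -> T i j = Empty,
      forall i j : 'I_n, (u^-1)%g j < i -> u i < j -> T i j = Horizontal
    & (forall i j : 'I_n, i < (u^-1)%g j -> j < u i -> T i j = Vertical) /\
      (forall i j : 'I_n, i < (u^-1)%g j -> u i < j ->
         T i j = Cross \/ T i j = Elbow)].

Definition is_reduced : Prop :=
  forall k l : 'I_n, k != l ->
    #|[set b : 'I_n * 'I_n | cross_at k l b.1 b.2]| <= 1.

Definition is_exit_permutation (v : 'S_n) : Prop :=
  forall i : 'I_n, on_pipe (v i) (row_exit i).

Definition no_touch_after_cross : Prop :=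
  forall k l i j i' j' : 'I_n, k != l ->
    cross_at k l i j -> i <= i' -> j <= j' -> ~~ touch_at k l i' j'.

Definition is_FPP (u v : 'S_n) : Prop :=
  [/\ is_rothe_pipe_dream u, is_reduced, is_exit_permutation v
    & no_touch_after_cross].

Definition num_elbows : nat :=
  #|[set b : 'I_n * 'I_n | T b.1 b.2 == Elbow]|.

End Pipes.

(* Main.v *)
(* Read the tiles row by row, each row from left to right, and keep track of a
   permutation w: when the boxes before (i, j) have been read, w i is the label
   of the pipe entering (i, j) from the left and w k, for k > i, the label of
   the pipe in the column u_k of the k-th pivot. A cross leaves w unchanged and
   an elbow in box (i, u_k) exchanges w i and w k, so w goes from u to v. Order
   the positions as the cut through the array meets them, from the lower left
   to the upper right; at the box (i, u_k) the only change of this order is that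
   the adjacent positions i and k are exchanged. Hence two labels change their
   relative order exactly at their crossings, and T is an FPP iff w i < w k
   whenever a cross or an elbow is reached: otherwise the two pipes have crossed
   before and now cross again or touch.
   Then each elbow is a step up in Bruhat order, and the crossings are in
   bijection with the noninversions of v, the crosses and elbows together with
   the noninversions of u. Conversely, the condition w i < w k determines the
   tiling backwards from v; by the lifting property, u <= v implies at each time
   that u dominates w on the initial segments of the cut, which at time 0 forces
   w = u. *)
Require Import Defs.
From HB Require Import structures.
From mathcomp Require Import all_boot all_order all_algebra all_fingroup.
From mathcomp Require Import zify.

Set Implicit Arguments.
Unset Strict Implicit.
Unset Printing Implicit Defensive.

(** * Inversions and Coxeter length *)

Lemma val_neq n (p q : 'I_n) : p != q -> (p : nat) <> q.
Proof. by move=> /eqP neq /val_inj. Qed.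

Section Inversions.

Variable n : nat.
Implicit Types (w : 'S_n) (a b p q : 'I_n).

Definition inversions w : {set 'I_n * 'I_n} :=
  [set x : 'I_n * 'I_n | (x.1 < x.2) && (w x.2 < w x.1)].

Definition noninversions w : {set 'I_n * 'I_n} :=
  [set x : 'I_n * 'I_n | (x.1 < x.2) && (w x.1 < w x.2)].

Lemma card_inversionsC w :
  #|inversions w| + #|noninversions w| = #|[set x : 'I_n * 'I_n | x.1 < x.2]|.
Proof.
have -> : noninversions w = [set x : 'I_n * 'I_n | x.1 < x.2] :\: inversions w.
  apply/setP=> -[p q]; rewrite !inE /=; case: ltnP => //= lt_pq.
  have := contra_neq (@perm_inj _ w p q); rewrite -!val_eqE /=; lia.
rewrite -[RHS](cardsID (inversions w)); congr (_ + _); congr #|pred_of_set _|.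
by apply/setP=> -[p q]; rewrite !inE andbA andbb.
Qed.

Lemma inversions1 : inversions 1 = set0.
Proof. by apply/setP=> -[p q]; rewrite !inE !perm1 /=; lia. Qed.

(** The inversions of [w] inject into those of [tperm a b * w] other than [(a, b)]: a pair moves by
    [t] if its image is still increasing, and stays otherwise. *)
Lemma ltn_inversions_tperm w a b :
  a < b -> w a < w b -> #|inversions w| < #|inversions (tperm a b * w)|.
Proof.
move=> lt_ab lt_w; set t := tperm a b.
(* The inversions that [t] reverses involve a or b and are also inversions of [t * w] *)
pose f (x : 'I_n * 'I_n) := if t x.1 < t x.2 then (t x.1, t x.2) else x.
have ab_in : (a, b) \in inversions (t * w).
  by rewrite inE /= !permM tpermL tpermR lt_ab.
rewrite (cardsD1 (a, b) (inversions (t * w))) ab_in add1n ltnS.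
have f_inj : {in inversions w &, injective f}.
  move=> [p q] [p' q']; rewrite !inE /= /f /= => /andP[lt1 _] /andP[lt2 _].
  case: ifP => h1; case: ifP => h2 /= [].
  - by move=> /perm_inj-> /perm_inj->.
  - by move=> ep eq; move: h2; rewrite -ep -eq !tpermK lt1.
  - by move=> ep eq; move: h1; rewrite ep eq !tpermK lt2.
  by move=> -> ->.
rewrite -(card_in_imset f_inj); apply/subset_leq_card/subsetP=> y /imsetP[[p q]].
rewrite !inE /= => /andP[lt_pq inv_pq] ->; rewrite /f /=.
case: ifP => lt_t /=.
  rewrite !permM !tpermK lt_t inv_pq !andbT xpair_eqE negb_and.
  apply/negP => /negP; rewrite negb_or !negbK => /andP[/eqP ea /eqP eb].
  move: lt_pq; rewrite -(tpermK a b p) -(tpermK a b q) ea eb tpermL tpermR; lia.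
rewrite lt_pq /= !permM andbC xpair_eqE negb_and.
move: lt_t; rewrite /t.
case: tpermP => [ep|ep|/eqP/val_neq ? /eqP/val_neq ?];
  case: tpermP => [eq|eq|/eqP/val_neq ? /eqP/val_neq ?];
  subst; rewrite -?val_eqE /=; lia.
Qed.

Lemma ltn_inversions_tpermE w a b : a < b ->
  (#|inversions w| < #|inversions (tperm a b * w)|) = (w a < w b).
Proof.
move=> lt_ab; apply/idP/idP=> [lt_inv|]; last exact: ltn_inversions_tperm.
case: ltngtP => // [lt_w|/val_inj/perm_inj eq_ab]; last by rewrite eq_ab ltnn in lt_ab.
have := @ltn_inversions_tperm (tperm a b * w) a b lt_ab.
rewrite !permM tpermL tpermR mulgA tperm2 mul1g => /(_ lt_w).
by rewrite ltnNge ltnW.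
Qed.

(** Exchanging two adjacent positions keeps the order of every pair except [(a, b)], so it maps all
    other inversions injectively to inversions of [w]. *)
Lemma leq_inversions_simple w a b :
  b = a.+1 :> nat -> #|inversions (tperm a b * w)| <= #|inversions w|.+1.
Proof.
move=> eb; rewrite (cardsD1 (a, b)) -add1n leq_add ?leq_b1 //.
set t := tperm a b; pose f (x : 'I_n * 'I_n) := (t x.1, t x.2).
have f_inj : injective f by move=> [p q] [p' q'] [/perm_inj-> /perm_inj->].
rewrite -(card_imset _ f_inj); apply/subset_leq_card/subsetP=> y /imsetP[[p q]].
rewrite !inE /= !permM xpair_eqE negb_and => /and3P[neq lt_pq lt_w] ->.
rewrite /f /= lt_w andbT; move: neq; rewrite /t.
case: tpermP => [ep|ep|/eqP/val_neq ? /eqP/val_neq ?];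
  case: tpermP => [eq|eq|/eqP/val_neq ? /eqP/val_neq ?];
  subst; rewrite -?val_eqE /= ?eqxx; lia.
Qed.

(** Both permutations have the same sum of values, so no inequality can be strict. *)
Lemma perm_leq_eq (u w : 'S_n) : (forall p, u p <= w p) -> u = w.
Proof.
have sumE (x : 'S_n) : \sum_p x p = \sum_(p < n) p.
  by rewrite [RHS](reindex_perm x).
move=> le_uw; have [_] := leqif_sum (fun p (_ : xpredT p) => leqif_eq (le_uw p)).
rewrite !sumE eqxx => /esym/forall_inP eq_uw.
by apply/permP=> p; apply/val_inj/eqP/eq_uw.
Qed.

(** Without a descent the values increase, so [p <= w p] for all [p], which forces the identity. *)
Lemma ex_descent w : w != 1%g -> exists a b, b = a.+1 :> nat /\ w b < w a.
Proof.
have [|no_desc] := boolP [exists a : 'I_n, exists b : 'I_n, (b == a.+1 :> nat) && (w b < w a)].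
  by move=> /existsP[a /existsP[b /andP[/eqP ? ?]]] _; exists a, b.
case/eqP; apply/esym/perm_leq_eq => p; rewrite perm1.
case: p => m; elim: m => [//|m IHm] lt_m /=.
have /= := IHm (ltnW lt_m); set a := Ordinal _; set b := Ordinal _.
move/existsPn/(_ a)/existsPn/(_ b): no_desc; rewrite eqxx /= -leqNgt.
have := contra_neq (@perm_inj _ w a b); rewrite -!val_eqE /=; lia.
Qed.

Lemma leq_inversions_word k w :
  w \in (simple_transpositions n ^+ k)%g -> #|inversions w| <= k.
Proof.
elim: k w => [|k IHk] w.
  by rewrite expg0 => /set1P->; rewrite inversions1 cards0.
rewrite expgS => /mulsgP[_ y /imsetP[[a b] /[!inE] /= /eqP eb ->] /IHk le_y ->].
exact: leq_trans (leq_inversions_simple _ eb) _.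
Qed.

(** Exchanging the two entries of a descent removes exactly one inversion, so sorting [w] takes as
    many steps as it has inversions. *)
Lemma ex_inversions_word w :
  w \in (simple_transpositions n ^+ #|inversions w|)%g.
Proof.
have [m] := ubnP #|inversions w|; elim: m w => // m IHm w /ltnSE le_m.
have [->|/ex_descent[a [b [eb desc]]]] := eqVneq w 1%g.
  by rewrite inversions1 cards0 expg0 inE.
have lt_ab : a < b by rewrite eb.
have lt_inv : #|inversions (tperm a b * w)%g| < #|inversions w|.
  rewrite -{2}[w]mul1g -(tperm2 a b) -mulgA ltn_inversions_tpermE //.
  by rewrite !permM tpermL tpermR.
have -> : #|inversions w| = #|inversions (tperm a b * w)%g|.+1.
  apply/eqP; rewrite eqn_leq lt_inv andbT.
  by rewrite -{1}[w]mul1g -(tperm2 a b) -mulgA leq_inversions_simple.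
rewrite expgS; apply/mulsgP.
exists (tperm a b) (tperm a b * w)%g; last by rewrite mulgA tperm2 mul1g.
  by apply/imsetP; exists (a, b); rewrite ?inE /= ?eb.
by apply: IHm; apply: leq_trans lt_inv _.
Qed.

Lemma coxeter_lengthE w : coxeter_length w = #|inversions w|.
Proof.
rewrite /coxeter_length; case: ex_minnP => k /leq_inversions_word le_k min_k.
by apply/eqP; rewrite eqn_leq le_k min_k ?ex_inversions_word.
Qed.

Lemma coxeter_length_tperm w a b : a < b ->
  (coxeter_length w < coxeter_length (tperm a b * w)) = (w a < w b).
Proof. by rewrite !coxeter_lengthE; apply: ltn_inversions_tpermE. Qed.

End Inversions.

(** * The cut *)

Section Cut.

Variables (n : nat) (u : 'S_n).
Implicit Types (i k p q : 'I_n) (t : nat).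

(* Rank of the box (i, u_k) in the reading order. *)
Definition time i k := i * n + u k.

(** Columns are named by the row of their pivot: the pair [i], [k] stands for the box in row [i] and
    column [u k]. The free boxes are those where a cross or an elbow is allowed. *)
Definition free_box i k := (i < k) && (u i < u k).

(* Abscissa of the pipe at position [p] where the cut meets it, doubled so that
   the held pipe stays between two columns; after the end of row [p] it keeps
   growing, which puts the pipes that have left in the order of the cut. *)
Definition key t p := maxn (2 * u p) (2 * (t - p * n) - 1).

Definition precedes t p q := key t p < key t q.

Lemma row_sep (p q : nat) : p < q -> p * n + n <= q * n.
Proof. by move=> lt_pq; rewrite -mulSnr leq_mul2r lt_pq orbT. Qed.

Lemma perm_val_neq p q : p != q -> (u p : nat) <> u q.
Proof. by move=> /eqP neq /val_inj/perm_inj. Qed.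

(** The order of two positions starts as that of their columns and is reversed at most once, when
    the free box in row [p] and column [u q] is passed. *)
Lemma precedes_lt t p q : p < q -> precedes t p q = (u p < u q) && (t <= p * n + u q).
Proof.
move=> lt_pq; have := row_sep lt_pq; have := ltn_ord (u p); have := ltn_ord (u q).
rewrite /precedes /key; lia.
Qed.

Lemma precedesC t p q : p != q -> precedes t q p = ~~ precedes t p q.
Proof.
move=> neq; wlog lt_pq : p q neq / p < q.
  move=> IH; have /val_neq := neq; case: (ltngtP p q) => // lt _; first exact: IH.
  by rewrite (IH q p) ?negbK // eq_sym.
have := row_sep lt_pq; have := ltn_ord (u p); have := ltn_ord (u q).
have := perm_val_neq neq; rewrite /precedes /key; lia.
Qed.

Lemma precedesxx t p : precedes t p p = false.
Proof. exact: ltnn. Qed.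

Lemma precedes0 p q : precedes 0 p q = (u p < u q).
Proof. by rewrite /precedes /key !sub0n !maxn0 ltn_pmul2l. Qed.

(** In the end the cut is the right boundary, read from the bottom up. *)
Lemma precedes_last p q : precedes (n * n) p q = (q < p).
Proof.
have lt_prec (x y : 'I_n) : x < y -> precedes (n * n) x y = false.
  move=> lt_xy; rewrite precedes_lt //; apply/negP => /andP[_].
  have := row_sep lt_xy; have := row_sep (ltn_ord y); have := ltn_ord (u y); lia.
case: (ltngtP q p) => [lt|lt|/val_inj->].
- by rewrite precedesC ?lt_prec // -val_eqE /= ltn_eqF.
- by rewrite lt_prec.
- by rewrite precedesxx.
Qed.

Lemma precedes_step_lt i k p q : p < q ->
  precedes (time i k).+1 p q = precedes (time i k) p q && ~~ [&& p == i, q == k & free_box i k].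
Proof.
move=> lt_pq; rewrite !precedes_lt // /free_box /time.
have [epi|/val_neq ?] := eqVneq p i; first subst i.
  have [eqk|/perm_val_neq ?] := eqVneq q k; first subst k; rewrite /=; lia.
have := ltn_ord (u q); have := ltn_ord (u k).
case: (ltngtP p i) => // /row_sep; lia.
Qed.

Lemma precedes_step i k p q :
  ~~ [&& p == i, q == k & free_box i k] -> ~~ [&& q == i, p == k & free_box i k] ->
  precedes (time i k).+1 p q = precedes (time i k) p q.
Proof.
move=> h1 h2; case: (ltngtP p q) => [lt|lt|/val_inj->]; last by rewrite !precedesxx.
  by rewrite precedes_step_lt // h1 andbT.
have neq : q != p by rewrite -val_eqE /= ltn_eqF.
by rewrite !(precedesC _ neq) precedes_step_lt // h2 andbT.
Qed.

Lemma precedes_free i k : free_box i k -> precedes (time i k) i k.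
Proof. by case/andP=> lt_ik lt_u; rewrite precedes_lt // lt_u /=. Qed.

Lemma precedes_freeS i k : free_box i k -> precedes (time i k).+1 k i.
Proof.
move=> fr; have /andP[lt_ik _] := fr; rewrite precedesC ?precedes_step_lt //.
  by rewrite fr !eqxx andbF.
by rewrite -val_eqE /= ltn_eqF.
Qed.

(** The keys of [i] and [k] are now the consecutive numbers [2 * u k - 1] and [2 * u k], so no third
    position lies between them. *)
Lemma precedes_adj i k q : free_box i k -> q != i -> q != k ->
  precedes (time i k) i q = precedes (time i k) k q.
Proof.
move=> /andP[lt_ik lt_u] /[dup]/perm_val_neq uqi /val_neq qi /[dup]/perm_val_neq uqk _.
have := row_sep lt_ik; have := ltn_ord (u q); have := ltn_ord (u k).
rewrite /precedes /key /time.
case: (ltngtP q i) => // /row_sep; case: (ltngtP q k) => [/row_sep|/row_sep|/val_inj?]; subst; lia.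
Qed.

Lemma precedes_adjr i k q : free_box i k -> q != i -> q != k ->
  precedes (time i k) q i = precedes (time i k) q k.
Proof.
by move=> fr qi qk; rewrite precedesC 1?eq_sym // [RHS]precedesC 1?eq_sym // (precedes_adj fr).
Qed.

(** Since [i] and [k] are adjacent and reversed at this box, the transposition carries the old order
    to the new one. *)
Lemma precedes_tperm i k p q : free_box i k ->
  precedes (time i k).+1 (tperm i k p) (tperm i k q) = precedes (time i k) p q.
Proof.
move=> fr; have ik : i != k by case/andP: fr => ? _; rewrite -val_eqE /= ltn_eqF.
have bik := precedes_free fr; have bki := precedes_freeS fr.
have bki' : precedes (time i k) k i = false by rewrite precedesC // bik.
have bik' : precedes (time i k).+1 i k = false by rewrite precedesC 1?eq_sym // bki.
case: (tpermP i k p) => [->|->|/eqP pi /eqP pk];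
  case: (tpermP i k q) => [->|->|/eqP qi /eqP qk];
  rewrite ?precedesxx ?bik ?bki ?bik' ?bki' // precedes_step ?(negPf ik) ?(negPf qi)
    ?(negPf pi) ?(negPf qk) ?(negPf pk) ?andbF //.
- by rewrite -(precedes_adj fr).
- by rewrite (precedes_adj fr).
- by rewrite -(precedes_adjr fr).
- by rewrite (precedes_adjr fr).
Qed.

Lemma key_ge i k t p : time i k < t -> free_box i k -> p = i \/ p = k -> 2 * u k <= key t p.
Proof. by rewrite /time /key => lt_t /andP[? ?] [] ->; lia. Qed.

Lemma leq_keyS t p : key t p <= key t.+1 p.
Proof. by rewrite /key; lia. Qed.

Lemma key_held i k : free_box i k -> key (time i k) i = 2 * u k - 1.
Proof. by rewrite /key /time => /andP[]; lia. Qed.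

Lemma key_col i k : free_box i k -> key (time i k) k = 2 * u k.
Proof. by rewrite /key /time => /andP[/row_sep]; have := ltn_ord (u k); lia. Qed.

Lemma time_lt i k : time i k < n * n.
Proof.
rewrite /time; have := row_sep (ltn_ord i); have := ltn_ord (u k); lia.
Qed.

Lemma time_inj i k i' k' : time i k = time i' k' -> i = i' /\ k = k'.
Proof.
have := ltn_ord (u k); have := ltn_ord (u k'); rewrite /time => h1 h2 e.
have eqi : i = i'.
  by apply: val_inj; case: (ltngtP i i') => // /row_sep; lia.
by split=> //; apply/(@perm_inj _ u)/val_inj; rewrite eqi in e; rewrite /=; lia.
Qed.

Lemma time_surj t : t < n * n -> exists i k, t = time i k.
Proof.
move=> lt_t; have n_gt0 : 0 < n by case: (posnP n) lt_t => // {2}->; rewrite muln0.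
have lt_i : t %/ n < n by rewrite ltn_divLR.
exists (Ordinal lt_i), ((u^-1)%g (Ordinal (ltn_pmod t n_gt0))).
by rewrite /time permKV /= -divn_eq.
Qed.

Lemma time_ind (P : nat -> Prop) :
  P 0 -> (forall i k, P (time i k) -> P (time i k).+1) ->
  forall t, t <= n * n -> P t.
Proof.
move=> P0 PS; elim=> // t IHt lt_t.
by have [i [k e]] := time_surj lt_t; rewrite e; apply: PS; rewrite -e; apply/IHt/ltnW.
Qed.

Lemma time_rec (T : Type) (x0 : T) (f : 'I_n -> 'I_n -> T -> T) :
  exists x : nat -> T,
    x 0 = x0 /\ forall i k, x (time i k).+1 = f i k (x (time i k)).
Proof.
(* Ranks determine boxes, so the box picked is the one being read; the default occurs only from rank
   [n * n] on. *)
pose step t y := if [pick b : 'I_n * 'I_n | time b.1 b.2 == t] is Some b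
  then f b.1 b.2 y else y.
exists (fix x t := if t is t'.+1 then step t' (x t') else x0); split=> // i k.
rewrite {1}/step; case: pickP => [[i' k'] /= /eqP/time_inj[-> ->] //|/(_ (i, k))].
by rewrite /= eqxx.
Qed.

Lemma time_rec_down (T : Type) (x0 : T) (f : 'I_n -> 'I_n -> T -> T) :
  exists x : nat -> T,
    x (n * n) = x0 /\ forall i k, x (time i k) = f i k (x (time i k).+1).
Proof.
pose step t y := if [pick b : 'I_n * 'I_n | time b.1 b.2 == t] is Some b
  then f b.1 b.2 y else y.
(* [y m] is the value when [m] boxes are still to be read. *)
pose y := fix y m := if m is m'.+1 then step (n * n - m'.+1) (y m') else x0.
exists (fun t => y (n * n - t)); split=> [|i k]; first by rewrite subnn.
have -> : n * n - time i k = (n * n - (time i k).+1).+1 by have := time_lt i k; lia.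
have e : n * n - (n * n - (time i k).+1).+1 = time i k by have := time_lt i k; lia.
rewrite /= e {1}/step; case: pickP => [[i' k'] /= /eqP/time_inj[-> ->] //|/(_ (i, k))].
by rewrite /= eqxx.
Qed.

End Cut.

(** * Runs and pipes *)

Section Run.

Variables (n : nat) (T : 'M[tile]_n) (u : 'S_n) (w : nat -> 'S_n).
Implicit Types (i j k p q a b : 'I_n) (t : nat) (x y : midpoint n).

Definition rothe_shape :=
  [/\ forall i, T i (u i) = PivotElbow,
      forall i k, k < i -> u k < u i -> T i (u k) = Empty,
      forall i k, k < i -> u i < u k -> T i (u k) = Horizontal,
      forall i k, i < k -> u k < u i -> T i (u k) = Vertical
    & forall i k, free_box u i k -> T i (u k) = Cross \/ T i (u k) = Elbow].

(** A predicate rather than a function, because [w] is computed forwards from a given tiling in one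
    direction and backwards from [v] in the other. *)
Definition is_run :=
  w 0 = u /\ forall i k, w (time u i k).+1 =
    if T i (u k) == Elbow then (tperm i k * w (time u i k))%g else w (time u i k).

Hypotheses (shapeT : rothe_shape) (run_w : is_run).

Lemma shape_box i k (s := T i (u k)) :
  (i = k /\ s = PivotElbow) \/ [\/ [/\ k < i, u k < u i & s = Empty],
      [/\ k < i, u i < u k & s = Horizontal], [/\ i < k, u k < u i & s = Vertical]
    | free_box u i k /\ (s = Cross \/ s = Elbow)].
Proof.
have [piv emp hor ver fr] := shapeT; rewrite /s.
have [<-|/[dup] /val_neq ne /(@perm_val_neq _ u) neu] := eqVneq i k.
  by left.
have [lt|lt|] := ltngtP i k; have [ltu|ltu|] := ltngtP (u i) (u k); try lia.
- by right; apply: Or44; split; [rewrite /free_box lt | apply: fr; rewrite /free_box lt].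
- by right; apply: Or43; split=> //; apply: ver.
- by right; apply: Or42; split=> //; apply: hor.
- by right; apply: Or41; split=> //; apply: emp.
Qed.

Lemma free_boxP i k : reflect (T i (u k) = Cross \/ T i (u k) = Elbow) (free_box u i k).
Proof.
apply: (iffP idP) => [fr|]; first by have [_ _ _ _] := shapeT; apply.
case: (shape_box i k) => [[_ ->]|[[_ _ ->]|[_ _ ->]|[_ _ ->]|[? _] _ //]]; by case.
Qed.

Lemma run_elbow i k : T i (u k) = Elbow ->
  w (time u i k).+1 = (tperm i k * w (time u i k))%g.
Proof. by have [_ ->] := run_w => ->. Qed.

Lemma run_not_elbow i k : T i (u k) <> Elbow -> w (time u i k).+1 = w (time u i k).
Proof. by have [_ ->] := run_w => /eqP/negPf->. Qed.

Lemma run_fix k t t' : t <= t' <= n * n ->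
  (forall i k', free_box u i k' -> t <= time u i k' < t' -> k != i /\ k != k') ->
  w t' k = w t k.
Proof.
case/andP; elim: t' => [|t' IH]; first by rewrite leqn0 => /eqP->.
rewrite leq_eqVlt => /predU1P[<- //|]; rewrite ltnS => le_tt' lt_t' neqk.
rewrite -{}IH ?(ltnW lt_t') // => [|i k' fr /andP[? ?]]; last by apply: neqk => //; lia.
have [i [k' et']] := time_surj u lt_t'; subst t'.
have [|ne] := eqVneq (T i (u k')) Elbow; last by rewrite run_not_elbow //; apply/eqP.
move=> /[dup] e /run_elbow ->.
have fr : free_box u i k' by apply/free_boxP; right.
have [|ki kk'] := neqk i k' fr; first by rewrite le_tt' /=.
by rewrite permM tpermD // eq_sym.
Qed.

(** A free box involving position [k] lies in column [u k], or in row [k] to the right of the pivot;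
    none of these is read in between. *)
Lemma run_bottom i k : i < k -> w (i.+1 * n + u k) k = w (time u i k).+1 k.
Proof.
move=> lt_ik; apply: run_fix => [|i' k' /andP[lt_ik' lt_u]].
  have := row_sep n lt_ik; have := row_sep n (ltn_ord k); have := ltn_ord (u k).
  by rewrite /time mulSn; lia.
rewrite /time mulSn => bds; split; apply/eqP => e; subst.
  have [lt|lt|e] := ltngtP i.+1 i'; last by rewrite -e mulSn in bds; lia.
    by have := row_sep n lt; rewrite mulSn; lia.
  lia.
have [lt|lt|e] := ltngtP i i'; last by rewrite -e in bds; lia.
  have := row_sep n lt; lia.
have := row_sep n lt; lia.
Qed.

Lemma run_start k : w (u k) k = u k.
Proof.
have [w0 _] := run_w; rewrite -[in RHS]w0; apply: run_fix => [|i k' /andP[lt_ik lt_u]].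
  by rewrite leq0n; have := row_sep n (ltn_ord k); have := ltn_ord (u k); lia.
by rewrite /time => ?; split; apply/eqP => e; subst; lia.
Qed.

Lemma run_exit i : w (i * n + n) i = w (n * n) i.
Proof.
apply/esym/run_fix => [|i' k' /andP[lt_ik _]].
  by rewrite leqnn andbT row_sep.
rewrite /time => bds; have [lt|lt|e] := ltngtP i i'.
- by split; apply/eqP => e; subst; lia.
- by have := row_sep n lt; have := ltn_ord (u k'); lia.
- by rewrite -e in bds; have := ltn_ord (u k'); lia.
Qed.

(** The label is read just before the box that has the midpoint on its top or left edge; on the
    right boundary this is the end of the row. *)
Definition label x : 'I_n :=
  match x with
  | inl (i, j) => w (i * n + j) ((u^-1)%g j)
  | inr (i, j) => w (i * n + j) i
  end.

(* The midpoints met by some pipe. *)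
Definition active x : bool :=
  match x with
  | inl (i, j) => i <= (u^-1)%g j
  | inr (i, j) => u i < j
  end.

(** Each arc increases this number, so following a pipe backwards terminates. *)
Definition depth x : nat :=
  match x with
  | inl (i, j) => i + j
  | inr (i, j) => i + j
  end.

Lemma label_top i k : label (top_mid i (u k)) = w (time u i k) k.
Proof. by rewrite /= permK. Qed.

Lemma label_left i k : label (left_mid i (u k)) = w (time u i k) i.
Proof. by []. Qed.

Lemma label_right i k : label (right_mid i (u k)) = w (time u i k).+1 i.
Proof. by rewrite /= /bump /= add1n addnS. Qed.

Lemma label_bottom i k : i < k -> label (bottom_mid i (u k)) = w (time u i k).+1 k.
Proof. by move=> lt_ik; rewrite /= permK /bump /= add1n run_bottom. Qed.

Lemma arc_active x y : Defs.arc T x y ->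
  [/\ active x, active y, label y = label x & depth x < depth y].
Proof.
case/existsP=> i /existsP[j]; pose k := (u^-1)%g j.
have -> : j = u k by rewrite permKV.
case: (shape_box i k) => [[<- s]|[[lt ltu s]|[lt ltu s]|[lt ltu s]|[/andP[lt ltu] [s|s]]]];
  rewrite s ?inE => // /[!xpair_eqE].
- case/andP=> /eqP-> /eqP->; rewrite label_top label_right run_not_elbow ?s //.
  by split; rewrite //= ?permK /bump /=; lia.
- case/andP=> /eqP-> /eqP->; rewrite label_left label_right run_not_elbow ?s //.
  by split; rewrite //= ?permK /bump /=; lia.
- case/andP=> /eqP-> /eqP->; rewrite label_top label_bottom ?run_not_elbow ?s //.
  by split; rewrite //= ?permK /bump /=; lia.
- case/orP=> /andP[/eqP-> /eqP->]; rewrite ?label_top ?label_bottom ?label_left ?label_right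
    ?run_not_elbow ?s //; by split; rewrite //= ?permK /bump /=; lia.
- case/orP=> /andP[/eqP-> /eqP->]; rewrite ?label_top ?label_bottom ?label_left ?label_right
    ?(run_elbow s) ?permM ?tpermL ?tpermR //; by split; rewrite //= ?permK /bump /=; lia.
Qed.

Lemma arcI i j x y : (x, y) \in tile_arcs i j (T i j) -> Defs.arc T x y.
Proof. by move=> xy; apply/existsP; exists i; apply/existsP; exists j. Qed.

Lemma arc_into y : active y ->
  (exists2 k, y = pipe_start k & label y = k) \/ exists x, Defs.arc T x y.
Proof.
case: y => [[i j]|[i j]] /=.
  pose k := (u^-1)%g j; have ej : j = u k by rewrite permKV.
  case: i => [[|i] lt_i] /=.
    move=> _; left; exists j; first by congr (inl (_, _)); apply: val_inj.
    by rewrite ej permK run_start.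
  move=> lt_ik; have lt_in : i < n by [].
  pose i' := Ordinal lt_in.
  have -> : inl (Ordinal lt_i, j) = bottom_mid i' j by congr (inl (_, _)); apply: val_inj.
  right; case: (shape_box i' k) => [|[]]; rewrite -ej.
  - by case=> e; move: lt_ik; rewrite -/k -e ltnn.
  - by case=> /= lt; rewrite ltnNge ltnW in lt.
  - by case=> /= lt; rewrite ltnNge ltnW in lt.
  - by case=> _ _ s; exists (top_mid i' j); apply: (@arcI i' j); rewrite s inE.
  - case=> _ [] s; [exists (top_mid i' j) | exists (left_mid i' j)];
      by apply: (@arcI i' j); rewrite s !inE eqxx ?orbT.
case: j => [[|j] lt_j] //= lt_uj; have lt_jn : j < n by [].
pose j' := Ordinal lt_jn; pose k := (u^-1)%g j'; have ej : j' = u k by rewrite permKV.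
have -> : inr (i, Ordinal lt_j) = right_mid i j' by congr (inr (_, _)); apply: val_inj.
have leu : u i <= u k by rewrite -ej.
right; case: (shape_box i k) => [|[]]; rewrite -ej.
- by case=> _ s; exists (top_mid i j'); apply: (@arcI i j'); rewrite s inE.
- by case=> _; rewrite ltnNge -ltnS lt_uj.
- by case=> _ _ s; exists (left_mid i j'); apply: (@arcI i j'); rewrite s inE.
- by case=> _; rewrite ltnNge -ltnS lt_uj.
- case=> _ [] s; [exists (left_mid i j') | exists (top_mid i j')];
    by apply: (@arcI i j'); rewrite s !inE eqxx ?orbT.
Qed.

(** Labels are constant along arcs. Conversely, an active midpoint can be followed backwards, by
    induction on its depth, to the start of the column that its label names. *)
Lemma on_pipeE a x : on_pipe T a x = active x && (label x == a).
Proof.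
apply/idP/andP.
  case/connectP=> s pth ->; pose x0 := pipe_start a.
  have : active x0 /\ label x0 = a.
    by split=> //=; rewrite -[in RHS](permKV u a) -run_start permKV.
  rewrite -/x0 in pth *; elim: s x0 pth => [|y s IHs] x0 /=; first by move=> _ [-> ->].
  by case/andP=> /arc_active[_ act_y lab_y _] pth [_ lab_x]; apply: IHs; rewrite ?lab_y.
case=> act_x /eqP<-; have [m] := ubnP (depth x).
elim: m x act_x => // m IHm x act_x /ltnSE le_m.
case: (arc_into act_x) => [[k -> ->]|[y xy]]; first exact: connect0.
have [act_y _ -> lt_depth] := arc_active xy.
by apply: connect_trans (connect1 xy); apply: IHm => //; lia.
Qed.

Lemma run_n_pipes : n_pipes_top_to_right T.
Proof.
split=> [k|x y xy]; last first.
  by exists (label x); rewrite on_pipeE eqxx andbT; case: (arc_active xy).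
by exists ((w (n * n))^-1 k)%g; rewrite on_pipeE /= ltn_ord run_exit permKV eqxx.
Qed.

Lemma run_exit_permutation v : is_exit_permutation T v <-> w (n * n) = v.
Proof.
split=> [ex|<- i].
  apply/permP=> i; have := ex i.
  by rewrite on_pipeE /= ltn_ord run_exit => /eqP.
by rewrite on_pipeE /= ltn_ord run_exit eqxx.
Qed.

Lemma passes_throughE a i k : free_box u i k ->
  passes_through T a i (u k) = (a == w (time u i k) i) || (a == w (time u i k) k).
Proof.
move=> fr; have /andP[lt ltu] := fr.
have lab_l : on_pipe T a (left_mid i (u k)) = (a == w (time u i k) i).
  by rewrite on_pipeE label_left /= ltu eq_sym.
have lab_t : on_pipe T a (top_mid i (u k)) = (a == w (time u i k) k).
  by rewrite on_pipeE label_top /= permK ltnW // eq_sym.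
by case/free_boxP: fr => s; rewrite /passes_through s /= lab_l lab_t orbF // orbC.
Qed.

End Run.

(** * Crossings *)

Lemma pair_mem2 (A : eqType) (a b c d : A) : a != b ->
  ((a == c) || (a == d)) && ((b == c) || (b == d)) =
  ((a, b) == (c, d)) || ((a, b) == (d, c)).
Proof.
move=> ab; have neq x : ~~ ((a == x) && (b == x)).
  by apply: contra ab => /andP[/eqP-> /eqP->].
by rewrite !xpair_eqE; move: (neq c) (neq d); do 4 case: (_ == _).
Qed.

Section Labels.

Variables (n : nat) (T : 'M[tile]_n) (u : 'S_n) (w : nat -> 'S_n).
Implicit Types (i j k p q a b : 'I_n) (t : nat).

Hypotheses (shapeT : rothe_shape T u) (run_w : is_run T u w).

Notation time := (time u).
Notation held i k := (w (time i k) i).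
Notation falling i k := (w (time i k) k).

Definition label_precedes t a b := precedes u t ((w t)^-1 a)%g ((w t)^-1 b)%g.

(** At an elbow, the reversal of [i] and [k] in the cut is compensated by the exchange of the labels
    they carry. *)
Lemma label_precedes_step i k a b : T i (u k) <> Cross ->
  label_precedes (time i k).+1 a b = label_precedes (time i k) a b.
Proof.
move=> ncr; rewrite /label_precedes.
have [e|/eqP ne] := eqVneq (T i (u k)) Elbow; last first.
  have nfr : ~~ free_box u i k by apply/(free_boxP shapeT) => -[].
  by rewrite (run_not_elbow run_w ne) precedes_step // (negPf nfr) !andbF.
rewrite (run_elbow run_w e) invMg tpermV !permM precedes_tperm //.
by apply/(free_boxP shapeT); right.
Qed.

Lemma label_precedes_held i k : free_box u i k ->
  label_precedes (time i k) (held i k) (falling i k).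
Proof. by move=> fr; rewrite /label_precedes !permK precedes_free. Qed.

Lemma label_precedes_crossed i k : T i (u k) = Cross ->
  label_precedes (time i k).+1 (falling i k) (held i k).
Proof.
move=> s; rewrite /label_precedes (run_not_elbow run_w) ?s // !permK precedes_freeS //.
by apply/(free_boxP shapeT); left.
Qed.

Lemma label_precedesC t a b : a != b -> label_precedes t b a = ~~ label_precedes t a b.
Proof. by move=> ab; rewrite /label_precedes precedesC // (inj_eq perm_inj). Qed.

Lemma label_precedes_cross i k a b : T i (u k) = Cross ->
    (a, b) != (held i k, falling i k) -> (a, b) != (falling i k, held i k) ->
  label_precedes (time i k).+1 a b = label_precedes (time i k) a b.
Proof.
move=> s; rewrite !xpair_eqE => ne1 ne2.
rewrite /label_precedes (run_not_elbow run_w) ?s // precedes_step //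
  !(can2_eq (permKV _) (permK _)) andbA negb_and ?ne1 //.
by rewrite [in X in X || _]andbC ne2.
Qed.

(* By [label_precedes_step] and [label_precedes_cross], the pairs of labels that have
   crossed an odd number of times. *)
Definition crossed t : {set 'I_n * 'I_n} :=
  [set x : 'I_n * 'I_n | (x.1 < x.2) && label_precedes t x.2 x.1].

Lemma crossed0 : crossed 0 = set0.
Proof.
apply/setP=> -[a b]; rewrite !inE /label_precedes precedes0 /=.
by have [-> _] := run_w; rewrite !permKV; lia.
Qed.

Lemma crossed_step i k : T i (u k) <> Cross -> crossed (time i k).+1 = crossed (time i k).
Proof. by move=> ncr; apply/setP=> x; rewrite !inE label_precedes_step. Qed.

(** The set starts empty, and a pair can enter it only at a cross of its two pipes. *)
Lemma crossed_witness t a b : t <= n * n -> (a, b) \in crossed t ->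
  exists i k, [/\ time i k < t, T i (u k) = Cross &
    (a, b) = (held i k, falling i k) \/ (a, b) = (falling i k, held i k)].
Proof.
move: t; apply: (@time_ind _ u (fun t => _ -> _)) => [|i k IH]; first by rewrite crossed0 inE.
have [s|/eqP ncr] := eqVneq (T i (u k)) Cross; last first.
  rewrite crossed_step // => /IH[i' [k' [lt_t ? ?]]].
  by exists i', k'; split=> //; apply: ltnW.
have [e|ne1] := eqVneq (a, b) (held i k, falling i k).
  by exists i, k; split=> //; left.
have [e|ne2] := eqVneq (a, b) (falling i k, held i k).
  by exists i, k; split=> //; right.
rewrite !inE /= label_precedes_cross //.
- move=> ab; have [|i' [k' [lt_t ? ?]]] := IH; first by rewrite inE.
  by exists i', k'; split=> //; apply: ltnW.
- by apply: contra_neq ne2 => -[-> ->].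
- by apply: contra_neq ne1 => -[-> ->].
Qed.

Definition label_key t a := key u t ((w t)^-1 a)%g.

(** Pipes never move left: the two that meet at an elbow have keys at most [2 * u k] before it and
    at least [2 * u k] after it. *)
Lemma leq_label_key t t' a : t <= t' <= n * n -> label_key t a <= label_key t' a.
Proof.
case/andP; elim: t' => [|t' IH]; first by rewrite leqn0 => /eqP->.
rewrite leq_eqVlt => /predU1P[<- //|]; rewrite ltnS => le_tt' lt_t'.
apply: leq_trans (IH le_tt' (ltnW lt_t')) _.
have [i [k ->]] := time_surj u lt_t'; rewrite /label_key.
have [e|/eqP ne] := eqVneq (T i (u k)) Elbow; last first.
  by rewrite (run_not_elbow run_w ne) leq_keyS.
have fr : free_box u i k by apply/(free_boxP shapeT); right.
rewrite (run_elbow run_w e) invMg tpermV !permM.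
case: tpermP => [->|->|_ _]; last exact: leq_keyS.
  by rewrite (key_held fr) (leq_trans (leq_subr _ _)) // (@key_ge _ _ i) //; right.
by rewrite (key_col fr) // (@key_ge _ _ i) //; left.
Qed.

Lemma cross_atE a b i k : T i (u k) = Cross -> a != b ->
  cross_at T a b i (u k) =
  ((a, b) == (held i k, falling i k)) || ((a, b) == (falling i k, held i k)).
Proof.
move=> s ab; have fr : free_box u i k by apply/(free_boxP shapeT); left.
by rewrite /cross_at s eqxx /= !(passes_throughE shapeT run_w _ fr) pair_mem2.
Qed.

Lemma touch_atE a b i k : T i (u k) = Elbow -> a != b ->
  touch_at T a b i (u k) =
  ((a, b) == (held i k, falling i k)) || ((a, b) == (falling i k, held i k)).
Proof.
move=> s ab; have fr : free_box u i k by apply/(free_boxP shapeT); right.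
by rewrite /touch_at s eqxx /= !(passes_throughE shapeT run_w _ fr) pair_mem2.
Qed.

Definition increasing_run := forall i k, free_box u i k -> held i k < falling i k.

Lemma held_neq i k : free_box u i k -> held i k != falling i k.
Proof.
by case/andP=> lt_ik _; rewrite (inj_eq perm_inj) -val_eqE /= ltn_eqF.
Qed.

(** Labels that meet in decreasing order have crossed at an earlier box. A second cross contradicts
    reducedness; an elbow would be a touch southeast of that crossing. *)
Lemma FPP_increasing : is_reduced T -> no_touch_after_cross T -> increasing_run.
Proof.
move=> red ntc i k fr; have neq := held_neq fr; rewrite ltnNge; apply/negP => le_fh.
have lt_fh : falling i k < held i k by rewrite ltn_neqAle le_fh andbT eq_sym.
have [|i' [k' [lt_t s' lab']]] :=
  @crossed_witness (time i k) (falling i k) (held i k) (ltnW (time_lt u i k)).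
  by rewrite inE /= lt_fh label_precedes_held.
have cr' : cross_at T (held i k) (falling i k) i' (u k').
  by rewrite cross_atE //; case: lab' => [[-> ->]|[-> ->]]; rewrite eqxx ?orbT.
case/(free_boxP shapeT): (fr) => s; last first.
  have fr' : free_box u i' k' by apply/(free_boxP shapeT); left.
  have le_i : i' <= i.
    rewrite leqNgt; apply/negP => /(row_sep n).
    by have := ltn_ord (u k); rewrite /time in lt_t *; lia.
  (* A pipe of the crossing has key at least [2 * u k' - 1] there and at most [2 * u k] here; parity
     gives the bound. *)
  have le_u : u k' <= u k.
    have := @leq_label_key (time i' k') (time i k) (held i' k').
    rewrite {1}/label_key permK (key_held fr') (ltnW lt_t) (ltnW (time_lt u i k)) => /(_ isT).
    have [->|->] : held i' k' = held i k \/ held i' k' = falling i k.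
      by case: lab' => [[<- _]|[_ <-]]; auto.
      by rewrite /label_key permK (key_held fr); lia.
    by rewrite /label_key permK (key_col fr); lia.
  by have /negP[] := ntc _ _ _ _ i (u k) neq cr' le_i le_u; rewrite touch_atE // eqxx.
have cr : cross_at T (held i k) (falling i k) i (u k) by rewrite cross_atE // eqxx.
have /card_le1_eqP := red _ _ neq => /(_ (i, u k) (i', u k')).
rewrite !inE => /(_ cr cr') [ei /perm_inj ek].
by rewrite ei ek ltnn in lt_t.
Qed.

(** * Consequences of increasing meetings: pipe dream conditions, counting, Bruhat order *)

Section Increasing.

Hypothesis inc_w : increasing_run.

Lemma crossed_cross i k : T i (u k) = Cross ->
  crossed (time i k).+1 = (held i k, falling i k) |: crossed (time i k) /\
  (held i k, falling i k) \notin crossed (time i k).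
Proof.
move=> s; have fr : free_box u i k by apply/(free_boxP shapeT); left.
have lt := inc_w fr; have neq := held_neq fr.
split; last by rewrite inE /= lt /= label_precedesC // label_precedes_held.
apply/setP=> -[a b]; rewrite !inE /=.
have [[-> ->]|ne1] /= := eqVneq (a, b) (held i k, falling i k).
  by rewrite lt label_precedes_crossed.
have [[-> ->]|ne2] := eqVneq (a, b) (falling i k, held i k).
  by rewrite ltnNge ltnW.
rewrite label_precedes_cross //.
- by apply: contra_neq ne2 => -[-> ->].
- by apply: contra_neq ne1 => -[-> ->].
Qed.

Lemma subset_crossed t t' : t <= t' <= n * n -> crossed t \subset crossed t'.
Proof.
case/andP; elim: t' => [|t' IH]; first by rewrite leqn0 => /eqP->.
rewrite leq_eqVlt => /predU1P[<- //|]; rewrite ltnS => le_tt' lt_t'.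
apply: subset_trans (IH le_tt' (ltnW lt_t')) _.
have [i [k ->]] := time_surj u lt_t'.
have [s|/eqP ncr] := eqVneq (T i (u k)) Cross; last by rewrite crossed_step.
by have [-> _] := crossed_cross s; apply: subsetUr.
Qed.

(** A crossed pair stays in [crossed], whereas a pair about to meet in increasing order is not in
    it. *)
Lemma crossed_once i k i' k' : T i (u k) = Cross -> free_box u i' k' ->
    time i k < time i' k' ->
  (held i k, falling i k) <> (held i' k', falling i' k') /\
  (held i k, falling i k) <> (falling i' k', held i' k').
Proof.
move=> s fr' lt_t; have fr : free_box u i k by apply/(free_boxP shapeT); left.
have in_cr : (held i k, falling i k) \in crossed (time i' k').
  have /subset_crossed/subsetP-> // : (time i k).+1 <= time i' k' <= n * n.
    by rewrite lt_t ltnW ?time_lt.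
  by have [-> _] := crossed_cross s; rewrite setU11.
split=> e; last by have := inc_w fr; have := inc_w fr'; case: e => <- <-; lia.
move: in_cr; rewrite e inE /= label_precedesC ?held_neq // label_precedes_held //.
by rewrite andbF.
Qed.

Lemma increasing_reduced : is_reduced T.
Proof.
move=> a b ab; apply/card_le1_eqP => -[i j] [i' j']; rewrite !inE /=.
rewrite -[j](permKV u) -[j'](permKV u); move: (u^-1 j)%g (u^-1 j')%g => k k' {j j'} cr cr'.
have [s s'] : T i (u k) = Cross /\ T i' (u k') = Cross.
  by split; apply/eqP; [case/and3P: cr | case/and3P: cr'].
have fr : free_box u i k by apply/(free_boxP shapeT); left.
have fr' : free_box u i' k' by apply/(free_boxP shapeT); left.
move: cr cr'; rewrite !cross_atE // => cr cr'.
have [lt_t|lt_t|/time_inj[-> ->] //] := ltngtP (time i k) (time i' k').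
  have [n1 n2] := crossed_once s fr' lt_t.
  by case/orP: cr cr' => /eqP[-> ->] /orP[] /eqP[? ?]; [case: n1|case: n2|case: n2|case: n1];
    congr (_, _).
have [n1 n2] := crossed_once s' fr lt_t.
by case/orP: cr cr' => /eqP[-> ->] /orP[] /eqP[? ?]; [case: n1|case: n2|case: n2|case: n1];
  congr (_, _).
Qed.

Lemma increasing_no_touch : no_touch_after_cross T.
Proof.
move=> a b i j i' j'; rewrite -[j](permKV u) -[j'](permKV u).
move: (u^-1 j)%g (u^-1 j')%g => k k' {j j'} ab cr le_i le_u; apply/negP => tc.
have [s s'] : T i (u k) = Cross /\ T i' (u k') = Elbow.
  by split; apply/eqP; [case/and3P: cr | case/and3P: tc].
have fr' : free_box u i' k' by apply/(free_boxP shapeT); right.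
have lt_t : time i k < time i' k'.
  rewrite ltn_neqAle; apply/andP; split; last by rewrite leq_add // leq_mul2r le_i orbT.
  by apply/eqP => /time_inj[ei ek]; rewrite ei ek s' in s.
have [n1 n2] := crossed_once s fr' lt_t.
move: cr tc; rewrite cross_atE // touch_atE // => cr tc.
by case/orP: cr tc => /eqP[-> ->] /orP[] /eqP[? ?]; [case: n1|case: n2|case: n2|case: n1];
  congr (_, _).
Qed.

Lemma card_crossed t : t <= n * n ->
  #|crossed t| =
  #|[set x : 'I_n * 'I_n | (T x.1 (u x.2) == Cross) && (time x.1 x.2 < t)]|.
Proof.
move: t; apply: (@time_ind _ u (fun t => _ = _)) => [|i k IH].
  by rewrite crossed0 cards0; apply/esym/eqP; rewrite cards_eq0; apply/eqP/setP=> x;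
    rewrite !inE andbF.
have time_ltS (x : 'I_n * 'I_n) :
    (time x.1 x.2 < (time i k).+1) = (x == (i, k)) || (time x.1 x.2 < time i k).
  rewrite ltnS leq_eqVlt; congr (_ || _); case: x => i' k' /=.
  by apply/eqP/eqP => [/time_inj[-> ->]|[-> ->]].
have [s|/eqP ncr] := eqVneq (T i (u k)) Cross.
  have [-> nin] := crossed_cross s; rewrite cardsU1 nin IH.
  rewrite [RHS](cardsD1 (i, k)) inE /= s eqxx ltnSn /=; congr (1 + #|pred_of_set _|).
  apply/setP=> x; rewrite !inE time_ltS.
  by have [->|_] := eqVneq x (i, k); rewrite //= ltnn andbF.
rewrite crossed_step // IH; congr #|pred_of_set _|.
apply/setP=> x; rewrite !inE time_ltS.
by have [->|_] //= := eqVneq x (i, k); move/eqP/negPf: ncr => ->.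
Qed.

(** On the right boundary read upwards, labels [a < b] are reversed when [a] leaves in a higher row
    than [b]. *)
Lemma card_crossed_last : #|crossed (n * n)| = #|noninversions (w (n * n))|.
Proof.
pose v := w (n * n); pose f (x : 'I_n * 'I_n) := (v x.1, v x.2).
have f_inj : injective f by move=> [p q] [p' q'] [/perm_inj-> /perm_inj->].
rewrite -[RHS](card_imset _ f_inj); congr #|pred_of_set _|.
apply/setP=> -[a b]; rewrite inE /label_precedes precedes_last -/v /=.
apply/idP/imsetP => [|[[p q]]].
  move=> /andP[lt_ab lt_v]; exists ((v^-1)%g a, (v^-1)%g b).
    by rewrite inE /= !permKV lt_ab lt_v.
  by rewrite /f /= !permKV.
by rewrite inE /= => /andP[lt lt_v] [-> ->]; rewrite !permK lt lt_v.
Qed.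

Lemma num_elbowsE :
  num_elbows T + #|noninversions (w (n * n))| = #|noninversions u|.
Proof.
pose f (x : 'I_n * 'I_n) := (x.1, u x.2).
have f_inj : injective f by move=> [p q] [p' q'] [-> /perm_inj->].
have -> : num_elbows T = #|[set x : 'I_n * 'I_n | T x.1 (u x.2) == Elbow]|.
  rewrite -[RHS](card_imset _ f_inj); congr #|pred_of_set _|.
  apply/setP=> -[i j]; rewrite inE /=; apply/idP/imsetP => [e|[[p q]]].
    by exists (i, (u^-1)%g j); rewrite ?inE /f /= permKV.
  by rewrite inE /= => e [-> ->].
(* Elbows and crosses are disjoint, and together they fill the free boxes, which are the
   noninversions of [u]. *)
rewrite -card_crossed_last card_crossed // -cardsUI.
rewrite [X in _ + X](_ : _ = 0) ?addn0; last first.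
  apply/eqP; rewrite cards_eq0; apply/eqP/setP=> x; rewrite !inE.
  by case: eqP => // ->.
congr #|pred_of_set _|; apply/setP=> -[i k]; rewrite !inE time_lt andbT /=.
rewrite -/(free_box u i k); apply/orP/(free_boxP shapeT) => -[]; by [move/eqP; auto|move->; auto].
Qed.

Lemma bruhat_run t : t <= n * n -> bruhat_le u (w t).
Proof.
move: t; apply: (@time_ind _ u (fun t => is_true (bruhat_le u (w t)))) => [|i k IH].
  by have [-> _] := run_w; apply: connect0.
have [e|/eqP ne] := eqVneq (T i (u k)) Elbow; last by rewrite (run_not_elbow run_w).
have fr : free_box u i k by apply/(free_boxP shapeT); right.
rewrite (run_elbow run_w e); apply: connect_trans IH (connect1 _).
rewrite /bruhat_step /= coxeter_length_tperm ?inc_w ?andbT //; last by case/andP: fr.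
by apply/existsP; exists i; apply/existsP; exists k.
Qed.

End Increasing.

End Labels.

(** * The backward construction *)

Section Domination.

Variable n : nat.
Implicit Types (S : {set 'I_n}) (u v w x y : 'S_n) (i k p q : 'I_n) (b : nat).

(** Comparing these numbers for every [b] compares the sorted values on [S] entry by entry, without
    sorting. *)
Definition count_geq S w b := \sum_(p in S) (b <= w p).

Lemma count_geqD1 p S w b : p \in S ->
  count_geq S w b = (b <= w p) + count_geq (S :\ p) w b.
Proof. by move=> Sp; rewrite /count_geq (big_setD1 p). Qed.

Lemma count_geq_tperm i k S w b : (i \in S) = (k \in S) ->
  count_geq S (tperm i k * w)%g b = count_geq S w b.
Proof.
move=> eqS; rewrite /count_geq [RHS](reindex_inj (@perm_inj _ (tperm i k))).
apply: eq_big => [p|p _]; last by rewrite permM.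
by case: tpermP => [->|->|].
Qed.

Lemma count_geq_notin i k S w b : i \notin S -> k \notin S ->
  count_geq S (tperm i k * w)%g b = count_geq S w b.
Proof. by move=> Si Sk; rewrite count_geq_tperm // (negPf Si) (negPf Sk). Qed.

(** A step up moves the smaller of two values to the later position. It affects [S] only if [S]
    contains the later position alone, and then the count cannot grow. *)
Lemma bruhat_le_count u v S b :
    bruhat_le u v -> (forall p q, p \in S -> p < q -> q \in S) ->
  count_geq S v b <= count_geq S u b.
Proof.
case/connectP=> s pth -> upS; elim: s u pth => //= w s IHs u /andP[step pth].
apply: leq_trans (IHs w pth) _; move: step {pth}.
case/andP=> /existsP[i /existsP[k /eqP->]].
wlog lt_ik : i k / i < k.
  move=> IH; case: (ltngtP i k) => [|lt|/val_inj->]; first exact: IH.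
    by rewrite tpermC; apply: IH.
  by rewrite tperm1 mul1g ltnn.
rewrite coxeter_length_tperm // => lt_u.
have [Si|nSi] := boolP (i \in S).
  by rewrite count_geq_tperm // Si (upS i k).
have [Sk|nSk] := boolP (k \in S); last by rewrite count_geq_notin.
rewrite !(count_geqD1 _ _ Sk) permM tpermR count_geq_notin ?inE ?eqxx //; last first.
  by rewrite (negPf nSi) andbF.
by rewrite leq_add2r; lia.
Qed.

Variable u : 'S_n.

(* The tableau criterion, relative to the order of the cut at time [t]. *)
Definition dominated t y := forall S b,
  (forall p q, q \in S -> precedes u t p q -> p \in S) ->
  count_geq S y b <= count_geq S u b.

Lemma dominated0 y : dominated 0 y -> y = u.
Proof.
move=> dom; apply: perm_leq_eq => p; rewrite leqNgt; apply/negP => lt_uy.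
(* On this initial segment no value of [u] reaches the threshold, so none of [y] may. *)
have := dom [set q | u q <= u p] (u p).+1.
rewrite [X in _ <= X]big1 => [|q]; last by rewrite inE; case: leqP => //; lia.
rewrite (@count_geqD1 p) ?inE // lt_uy => /(_ _)/wrap[] // q q'; rewrite !inE precedes0; lia.
Qed.

Lemma dominated_last v : bruhat_le u v -> dominated (n * n) v.
Proof.
move=> le_uv S b dn; apply: bruhat_le_count => // p q Sp lt_pq.
by apply: dn Sp _; rewrite precedes_last.
Qed.

Lemma dominated_not_free i k y : ~~ free_box u i k ->
  dominated (time u i k).+1 y -> dominated (time u i k) y.
Proof.
move=> nfr dom S b dn; apply: dom => p q Sq.
by rewrite precedes_step ?(negPf nfr) ?andbF //; apply: dn.
Qed.

(** This is the lifting step. As [i] precedes [k], the only segments [S] that are not initial after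
    the box contain [i] but not [k]; for these, [S :\ i] and [k |: S] are initial after the box, and
    their two bounds are combined. *)
Lemma dominated_free i k x y : free_box u i k ->
    y i < y k -> y = x \/ y = (tperm i k * x)%g ->
  dominated (time u i k).+1 x -> dominated (time u i k) y.
Proof.
move=> fr lt_y eq_y dom S b dn.
have ik : i != k by case/andP: fr => ? _; rewrite -val_eqE /= ltn_eqF.
have bik := precedes_free fr; have bki := precedes_freeS fr.
have eqc (R : {set 'I_n}) : (i \in R) = (k \in R) -> count_geq R y b = count_geq R x b.
  by case: eq_y => -> // /count_geq_tperm.
have [Sk|nSk] := boolP (k \in S).
  have Si : i \in S by apply: dn Sk bik.
  rewrite eqc ?Si ?Sk //; apply: dom => p q Sq.
  have [->|pi] := eqVneq p i; first by [].
  have [->|pk] := eqVneq p k; first by [].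
  by rewrite precedes_step ?(negPf pi) ?(negPf pk) ?andbF //; apply: dn.
have stepE p q : ~~ ((p == i) && (q == k)) -> ~~ ((q == i) && (p == k)) ->
    precedes u (time u i k).+1 p q = precedes u (time u i k) p q.
  by move=> h1 h2; rewrite precedes_step // andbA negb_and ?h1 ?h2.
have [Si|nSi] := boolP (i \in S); last first.
  rewrite eqc ?(negPf nSi) ?(negPf nSk) //; apply: dom => p q Sq.
  rewrite stepE; first exact: dn.
    by apply: contraNN nSk => /andP[_ /eqP<-].
  by apply: contraNN nSi => /andP[/eqP<-].
have := dom (S :\ i) b; have := dom (k |: S) b.
rewrite !(@count_geqD1 k (k |: S)) ?setU11 // setU1K //.
rewrite !(@count_geqD1 i S) // -(eqc (S :\ i)) ?inE ?eqxx ?(negPf nSk) ?andbF //.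
move=> dom1 dom2.
have {}dom1 : (b <= x k) + ((b <= x i) + count_geq (S :\ i) y b) <=
              (b <= u k) + ((b <= u i) + count_geq (S :\ i) u b).
  apply: dom1 => p q; rewrite !inE; have [//|pk] := eqVneq p k.
  case/predU1P=> [->|Sq].
    have [->|pi] := eqVneq p i; first by rewrite Si.
    by rewrite stepE ?(negPf pk) ?(negPf pi) ?andbF // -(precedes_adjr fr) //; apply: dn.
  rewrite stepE ?(negPf pk) ?andbF //; first exact: dn.
  by apply: contraNN nSk => /andP[_ /eqP<-].
have {}dom2 : count_geq (S :\ i) y b <= count_geq (S :\ i) u b.
  apply: dom2 => p q; rewrite !inE => /andP[qi Sq].
  have qk : q != k by apply: contraNneq nSk => <-.
  rewrite stepE ?(negPf qk) ?(negPf qi) ?andbF // => bpq.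
  rewrite (dn p q) // andbT; apply: contraNneq nSk => pi.
  by move: bpq; rewrite pi (precedes_adj fr) ?qi ?qk //; apply: dn.
(* [y i] is the smaller of [x i] and [x k]. If it reaches [b], both do, and dropping [k] from the
   bound for [k |: S] suffices; otherwise the bound for [S :\ i] does. *)
have : (b <= y i) <= (b <= x i) /\ (b <= y i) <= (b <= x k).
  case: eq_y lt_y => ->; rewrite ?permM ?tpermL ?tpermR; lia.
move: dom1 dom2; clear; case: (b <= y i); case: (b <= x i); case: (b <= x k);
  case: (b <= u i); case: (b <= u k) => /=; lia.
Qed.

End Domination.

(** * Flag positroid pipe dreams as increasing runs *)

Section FPP.

Variables (n : nat) (T : 'M[tile]_n) (u v : 'S_n).

Lemma is_rothe_pipe_dreamE :
  is_rothe_pipe_dream T u <-> n_pipes_top_to_right T /\ rothe_shape T u.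
Proof.
split=> [[np piv emp hor [ver fr]]|[np [piv emp hor ver fr]]].
  split=> //; split=> // i k.
  - by move=> lt; apply: emp; rewrite permK.
  - by move=> lt; apply: hor; rewrite permK.
  - by move=> lt; apply: ver; rewrite permK.
  - by case/andP=> lt ltu; apply: fr; rewrite ?permK.
split=> // [i j|i j|]; last split=> i j; rewrite -[j](permKV u) permK.
- exact: emp.
- exact: hor.
- exact: ver.
- by move=> lt ltu; apply: fr; apply/andP.
Qed.

Lemma FPP_run : is_FPP T u v ->
  exists w, [/\ rothe_shape T u, is_run T u w, w (n * n) = v & increasing_run u w].
Proof.
case=> /is_rothe_pipe_dreamE[_ shapeT] red ex ntc.
have [w run_w] := time_rec u u (fun i k (x : 'S_n) =>
  if T i (u k) == Elbow then (tperm i k * x)%g else x).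
exists w; split=> //; first exact/(run_exit_permutation shapeT run_w).
exact: FPP_increasing run_w red ntc.
Qed.

Lemma run_FPP w : rothe_shape T u -> is_run T u w -> increasing_run u w ->
  is_FPP T u (w (n * n)).
Proof.
move=> shapeT run_w inc_w; split.
- by apply/is_rothe_pipe_dreamE; split=> //; apply: run_n_pipes run_w.
- exact: increasing_reduced run_w inc_w.
- exact/(run_exit_permutation shapeT run_w).
- exact: increasing_no_touch run_w inc_w.
Qed.

End FPP.

Lemma bruhat_le_FPP n (u v : 'S_n) :
  bruhat_le u v -> exists T : 'M[tile]_n, is_FPP T u v.
Proof.
move=> le_uv.
(* Here [x] is the permutation after the box. Labels in decreasing order must come from an elbow,
   whose exchange is undone; labels in increasing order come from a cross. *)
pose swap i k (x : 'S_n) := free_box u i k && (x k < x i).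
have [w [w_last stepw]] := time_rec_down u v (fun i k (x : 'S_n) =>
  if swap i k x then (tperm i k * x)%g else x).
have inc_w : increasing_run u w.
  move=> i k fr; rewrite stepw /swap fr /=; set x := w _.
  case: (ltngtP (x k) (x i)) => // [|e]; first by rewrite !permM tpermL tpermR.
  by case/andP: fr; rewrite (perm_inj (val_inj e)) ltnn.
have dom t : t <= n * n -> dominated u (n * n - t) (w (n * n - t)).
  elim: t => [_|t IHt lt_t]; first by rewrite subn0 w_last; apply: dominated_last.
  have [|i [k eq_t]] := @time_surj n u (n * n - t.+1); first by lia.
  have {}IHt : dominated u (time u i k).+1 (w (time u i k).+1).
    by rewrite -eq_t -subSn // subSS; apply/IHt/ltnW.
  rewrite eq_t; have [fr|nfr] := boolP (free_box u i k).
    apply: dominated_free (fr) (inc_w _ _ fr) _ IHt.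
    by rewrite stepw; case: ifP; [right|left].
  by rewrite stepw /swap (negPf nfr); apply: dominated_not_free.
have w0 : w 0 = u by apply: dominated0; have := dom _ (leqnn _); rewrite subnn.
pose tile_at (i k : 'I_n) :=
  if i == k then PivotElbow
  else if k < i then if u k < u i then Empty else Horizontal
  else if u k < u i then Vertical
  else if w (time u i k).+1 k < w (time u i k).+1 i then Elbow else Cross.
pose T : 'M[tile]_n := (\matrix_(i, j) tile_at i (u^-1 j)%g)%R.
have TE i k : T i (u k) = tile_at i k by rewrite mxE permK.
exists T; rewrite -w_last; apply: run_FPP => //.
  split=> i => [|k lt|k lt ltu|k lt ltu|k /andP[lt ltu]]; rewrite TE /tile_at ?eqxx //;
    rewrite -val_eqE /= ?lt ?(gtn_eqF lt) ?(ltn_eqF lt) //.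
  - by move=> ->.
  - by rewrite ltnNge ltnW.
  - by rewrite ltnNge ltnW //= ltu.
  - by rewrite 2!ltnNge (ltnW lt) (ltnW ltu) /=; case: ifP; auto.
split=> // i k; rewrite stepw /swap TE /tile_at.
rewrite /free_box -val_eqE /=.
case: (ltngtP i k) => //= lt.
- case: (ltngtP (u i) (u k)) => //= ltu.
  + by case: (w _ k < w _ i); rewrite /= ?mulgA ?tperm2 ?mul1g.
  + by move/val_inj/perm_inj: ltu lt => ->; rewrite ltnn.
- by case: (u k < u i).
Qed.

Theorem theorem3p16 (n : nat) (u v : 'S_n) :
  ((exists T : 'M[tile]_n, is_FPP T u v) <-> bruhat_le u v) /\
  (forall T : 'M[tile]_n, is_FPP T u v ->
     ((coxeter_length v)%:Z - (coxeter_length u)%:Z = (num_elbows T)%:Z)%R).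
Proof.
split=> [|T /FPP_run[w [shapeT run_w <- inc_w]]].
  split=> [[T /FPP_run[w [shapeT run_w <- inc_w]]]|]; last exact: bruhat_le_FPP.
  exact: bruhat_run shapeT run_w inc_w _ (leqnn _).
(* Inversions and noninversions have the same total for [u] and [v], so the drop in noninversions is
   the gain in length. *)
have := num_elbowsE shapeT run_w inc_w; rewrite !coxeter_lengthE.
by have := card_inversionsC u; have := card_inversionsC (w (n * n)); lia.
Qed.
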